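(* Let $1 \le n \le N$ be integers. For every permutation $\sigma$ of $\{1,\dots,N\}$ (every initial ordering of the keys in the keyring), the lock-by-lock strategy and the key-by-key strategy require exactly the same number of trials to open all $n$ locks: $T^{\mathrm{lock}}_{n,N}(\sigma)=T^{\mathrm{key}}_{n,N}(\sigma)$.
   Context: There are $n$ locks, numbered $1,\dots,n$, and a keyring with $N\ge n$ keys, numbered $1,\dots,N$. For $1\le i\le n$, key $i$ opens lock $i$ and no other lock; keys $n+1,\dots,N$ open no lock. The person opening the locks does not know the numbers of the keys. An initial condition is a permutation $\sigma$ of $\{1,\dots,N\}$: the key in position $j$ of the keyring is key $\sigma(j)$. A trial consists of trying one key in one lock; the trial in which the key opens the lock is counted, and a trial is counted even if its outcome could be deduced in advance. Once a key has opened a lock, both the key and the lock are discarded; the remaining keys and remaining locks are those not discarded. Lock-by-lock strategy: treat the locks in the order $1,2,\dots,n$. For the current lock, try the remaining keys one after another in keyring order (increasing position), starting from the first remaining key, until the key opening the lock is found (this last trial being counted); then discard this lock and key and pass to the next lock, starting over with the first remaining key. $T^{\mathrm{lock}}_{n,N}(\sigma)$ is the total number of trials when all $n$ locks have been opened. Key-by-key strategy: treat the keys in keyring order (positions $1,2,\dots$). For the current key, try it in the remaining locks one after another in increasing order of lock number, starting from the first remaining lock, stopping when it opens a lock (this lock and key are then discarded) or when all remaining locks have been tried; then pass to the key in the next position. The process stops as soon as all $n$ locks have been opened. $T^{\mathrm{key}}_{n,N}(\sigma)$ is the total number of trials made. *)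

(* Defs.v *)
From mathcomp Require Import all_boot all_fingroup.

Set Implicit Arguments.
Unset Strict Implicit.
Unset Printing Implicit Defensive.

(* Locks are 'I_n, keys and keyring positions are 'I_N; numbering starts at 0
   instead of 1. *)
Definition opens (n N : nat) (k : 'I_N) (l : 'I_n) : bool := k == l :> nat.

(* Try the items of s from left to right, up to and including the first success
   (an item satisfying p). The result is the number of trials made, paired with
   s without the successful item (s itself if there was no success). *)
Fixpoint try_in_order (T : Type) (p : pred T) (s : seq T) : nat * seq T :=
  if s is x :: s' then
    if p x then (1, s')
    else let: (t, r) := try_in_order p s' in (t.+1, x :: r)
  else (0, [::]).

(* ls: remaining locks, by increasing number; ks: remaining keys, by increasing
   position. *)
Fixpoint lock_by_lock (n N : nat) (ls : seq 'I_n) (ks : seq 'I_N) : nat :=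
  if ls is l :: ls' then
    let: (t, ks') := try_in_order (fun k => opens k l) ks in
    t + lock_by_lock ls' ks'
  else 0.

(* The process stops as soon as no lock remains. The case where the keys run
   out first is a default value: it does not occur when n <= N and ks lists
   all the keys. *)
Fixpoint key_by_key (n N : nat) (ks : seq 'I_N) (ls : seq 'I_n) : nat :=
  match ls, ks with
  | [::], _ => 0
  | _, [::] => 0
  | _, k :: ks' =>
      let: (t, ls') := try_in_order (fun l => opens k l) ls in
      t + key_by_key ks' ls'
  end.

(* The key in position j is sigma j; enum 'I_m is 0, 1, ..., m - 1 in order. *)
Definition keyring (N : nat) (sigma : {perm 'I_N}) : seq 'I_N :=
  [seq sigma j | j <- enum 'I_N].

Definition T_lock (n N : nat) (sigma : {perm 'I_N}) : nat :=
  lock_by_lock (enum 'I_n) (keyring sigma).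

Definition T_key (n N : nat) (sigma : {perm 'I_N}) : nat :=
  key_by_key (keyring sigma) (enum 'I_n).

(* Main.v *)
Require Import Defs.
From mathcomp Require Import all_boot all_fingroup.

(** The lock-by-lock strategy also makes the trials that the key-by-key strategy
    makes with the first key. Deleting them leaves the lock-by-lock strategy
    for the other keys and the locks not opened by the first key, so induction
    on the keyring concludes. *)

Lemma lock_by_lock_nil (n N : nat) (ls : seq 'I_n) :
  lock_by_lock ls ([::] : seq 'I_N) = 0.
Proof. by elim: ls. Qed.

(** Until it opens a lock, [k] stays first on the keyring, so each lock treated begins with a trial
    of [k]; a lock that [k] opens sees no other key. *)
Lemma lock_by_lock_cons (n N : nat) (ls : seq 'I_n) (k : 'I_N) (ks : seq 'I_N) :
  lock_by_lock ls (k :: ks) =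
  (try_in_order (fun l => opens k l) ls).1
    + lock_by_lock (try_in_order (fun l => opens k l) ls).2 ks.
Proof.
elim: ls ks => [|l ls IH] ks //=; case: ifP => //= _.
case Eks: (try_in_order (fun k' => opens k' l) ks) => [t r] /=.
rewrite IH; case: (try_in_order (fun l' => opens k l') ls) => t' ls' /=.
(* Both sides count one trial of [k] in [l], [t] of the other keys in [l] and [t'] of [k] in [ls],
   in different orders. *)
by rewrite Eks !addSn addnCA.
Qed.

Lemma lock_by_lock_key_by_key (n N : nat) (ls : seq 'I_n) (ks : seq 'I_N) :
  lock_by_lock ls ks = key_by_key ks ls.
Proof.
(* Once the keys run out, both counts take the default value 0. *)
elim: ks ls => [|k ks IH] [|l ls]; rewrite ?lock_by_lock_nil //.
rewrite lock_by_lock_cons IH [RHS]/=.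
by rewrite -/(try_in_order _ (l :: ls)); case: try_in_order.
Qed.

Theorem mainTheorem1 (n N : nat) (hn : 1 <= n) (hnN : n <= N)
    (sigma : {perm 'I_N}) :
  T_lock n sigma = T_key n sigma.
Proof. exact: lock_by_lock_key_by_key. Qed.
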